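(* Let $A$ be a finite abelian group, $\chi$ a non-degenerate symmetric bicharacter of $A$, and $\tau$ a square root of $|A|^{-1}$. Let $m$ be the non-invertible simple object of $\mathcal{TY}(A,\chi,\tau)$, equipped with its canonical pivotal structure, and let $n\ge1$ be an integer. If $n$ is odd, then $\nu_n(m)=0$. Fix any $\rho\in C(\chi)$. If $n=2k$ is even, then $$\nu_n(m)=\frac{\mathrm{sgn}(\tau)^k}{\sqrt{|A|}}\sum_{a\in A}\widehat{\rho}(a)^k=\frac{\mathrm{sgn}(\tau)^k}{|A|^{\frac12(k-1)}}\,\rho^{*k}(1).$$
   Context: Everything is over $\mathbb{C}$; groups are written multiplicatively. A bicharacter of $A$ is a map $\chi: A\times A\to\mathbb{C}^\times$ multiplicative in each variable; it is symmetric if $\chi(a,b)=\chi(b,a)$, and non-degenerate if $\chi(x,a)=1$ for all $x\in A$ implies $a=1$. $C(\chi)$ is the (non-empty) set of functions $\rho:A\to\mathbb{C}^\times$ with $\rho(a)\rho(ab)^{-1}\rho(b)=\chi(a,b)$ for all $a,b\in A$. For a function $f:A\to\mathbb{C}$, $\widehat{f}(a)=\frac{1}{\sqrt{|A|}}\sum_{x\in A}f(x)\chi(x,a)^{-1}$ is its Fourier transform associated with $\chi$. The convolution is $(f*g)(a)=\sum_{x\in A}f(x)g(x^{-1}a)$, and $f^{*k}$ is the $k$-fold iterated convolution product of $f$. Tambara-Yamagami category. $\mathcal{TY}(A,\chi,\tau)$ (with $\tau\in\mathbb{R}$, $\tau^2=|A|^{-1}$) is the skeletal $\mathbb{C}$-linear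 monoidal category whose objects are finite direct sums of elements of $S=A\sqcup\{m\}$, with $\mathrm{Hom}(s,s')=\mathbb{C}$ if $s=s'$ and $0$ otherwise ($s,s'\in S$) and the obvious composition. The tensor product is $a\otimes b=ab$, $a\otimes m=m=m\otimes a$, $m\otimes m=\bigoplus_{x\in A}x$ ($a,b\in A$). The unit object is $1\in A$ with identity unit constraints. The associativity constraint $\Phi_{X,Y,Z}:(X\otimes Y)\otimes Z\to X\otimes(Y\otimes Z)$ is determined by $\Phi_{a,m,b}=\chi(a,b)\,\mathrm{id}_m$, $\Phi_{m,a,m}=(\chi(a,x)\delta_{x,y}\mathrm{id}_x)_{x,y}:\bigoplus_x x\to\bigoplus_y y$, $\Phi_{m,m,m}=(\tau\chi(x,y)^{-1}\mathrm{id}_m)_{x,y}:\bigoplus_{x\in A}m\to\bigoplus_{y\in A}m$, all other $\Phi_{s,t,u}$ ($s,t,u\in S$) being identities. The left dual of $a\in A$ is $a^{-1}$ with identity coevaluation and evaluation; the left dual of $m$ is $m$ with coevaluation the injection $1\to m\otimes m$ and evaluation $\tau^{-1}p$, where $p:m\otimes m\to1$ is the projection. The bidual functor is the identity, and the canonical pivotal structure is $j_a=\mathrm{id}_a$ ($a\in A$), $j_m=\mathrm{sgn}(\tau)\,\mathrm{id}_m$. Frobenius-Schur indicators. Let $\mathcal{C}$ be a $\mathbb{C}$-linear rigid monoidal category with pivotal structure $j:\mathrm{id}\to(-)^{**}$, coevaluations $d_V:1\to V\otimes V^*$ and evaluations $b_V:V^*\otimes V\to 1$. Put $V^{\otimes0}=1$,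 $V^{\otimes 1}=V$, $V^{\otimes n}=V\otimes V^{\otimes(n-1)}$ for $n\ge2$. Let $A^X_{Y,Z}:\mathrm{Hom}(X,Y\otimes Z)\to\mathrm{Hom}(Y^*\otimes X,Z)$ and $B^{X,Y}_Z:\mathrm{Hom}(X\otimes Y,Z)\to\mathrm{Hom}(X,Z\otimes Y^* )$ be the standard duality isomorphisms (up to associativity, $f\mapsto(b_Y\otimes\mathrm{id}_Z)(\mathrm{id}_{Y^*}\otimes f)$ and $g\mapsto(g\otimes\mathrm{id}_{Y^*})(\mathrm{id}_X\otimes d_Y)$). Define the linear automorphism $E_V^{(n)}$ of $\mathrm{Hom}(1,V^{\otimes n})$ by $E_V^{(n)}(f)=\Phi\circ(\mathrm{id}_{V^{\otimes(n-1)}}\otimes j_V^{-1})\circ B^{1,V^*}_{V^{\otimes(n-1)}}(A^1_{V,V^{\otimes(n-1)}}(f))$, where $\Phi:V^{\otimes(n-1)}\otimes V\to V^{\otimes n}$ is the associativity isomorphism. The $n$-th Frobenius-Schur indicator is $\nu_n(V)=\mathrm{Tr}(E_V^{(n)})$. *)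

(* Defs.v *)
From HB Require Import structures.
From mathcomp Require Import all_boot all_order all_algebra all_fingroup.
From mathcomp Require Import complex.
From mathcomp Require Import reals.

Set Implicit Arguments.
Unset Strict Implicit.
Unset Printing Implicit Defensive.

Import Order.TTheory GRing.Theory Num.Theory.
Local Open Scope ring_scope.
Local Open Scope complex_scope.

(* The trace of an endomorphism [f] of a finite-dimensional vector space.  It  *)
(* is computed in the basis chosen by the library, and is independent of that  *)
(* choice when [f] is linear.                                                  *)
Definition lin_trace (K : fieldType) (V : vectType K) (f : V -> V) : K :=
  \sum_(i < \dim {:V}) coord (vbasis {:V}) i (f (vbasis {:V})`_i).

(* The structure maps of a K-linear rigid monoidal category with a pivotal     *)
(* structure.  The Frobenius-Schur indicators depend on these maps only, so    *)
(* the coherence axioms are not recorded.  Composition is in applicative       *)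
(* order: [comp g f] is "g after f".                                           *)
Record pivotal_data (K : fieldType) := PivotalData {
  ob :> Type;
  hom : ob -> ob -> vectType K;
  idm : forall X, hom X X;
  comp : forall X Y Z, hom Y Z -> hom X Y -> hom X Z;
  tens : ob -> ob -> ob;
  tensm : forall X X' Y Y',
    hom X X' -> hom Y Y' -> hom (tens X Y) (tens X' Y');
  unit_ob : ob;
  assoc : forall X Y Z, hom (tens (tens X Y) Z) (tens X (tens Y Z));
  assoc_inv : forall X Y Z, hom (tens X (tens Y Z)) (tens (tens X Y) Z);
  lunit : forall X, hom (tens unit_ob X) X;
  lunit_inv : forall X, hom X (tens unit_ob X);
  runit : forall X, hom (tens X unit_ob) X;
  runit_inv : forall X, hom X (tens X unit_ob);
  dual : ob -> ob;
  coev : forall X, hom unit_ob (tens X (dual X));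
  ev : forall X, hom (tens (dual X) X) unit_ob;
  piv : forall X, hom X (dual (dual X));
  piv_inv : forall X, hom (dual (dual X)) X
}.

Arguments idm {K p} X.
Arguments comp {K p X Y Z} g f.
Arguments tens {K p} X Y.
Arguments tensm {K p X X' Y Y'} f g.
Arguments unit_ob {K p}.
Arguments assoc {K p} X Y Z.
Arguments assoc_inv {K p} X Y Z.
Arguments lunit {K p} X.
Arguments lunit_inv {K p} X.
Arguments runit {K p} X.
Arguments runit_inv {K p} X.
Arguments dual {K p} X.
Arguments coev {K p} X.
Arguments ev {K p} X.
Arguments piv {K p} X.
Arguments piv_inv {K p} X.

Section Indicator.
Variables (K : fieldType) (C : pivotal_data K).

Local Notation "X ⊗ Y" := (tens X Y) (at level 40, left associativity).
Local Notation "f ⊠ g" := (tensm f g) (at level 40, left associativity).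
Local Notation "g ∘ f" := (comp g f) (at level 45, right associativity).
Local Notation "1" := (@unit_ob K C).

(* Hom(X, Y ⊗ Z) -> Hom(Y* ⊗ X, Z) *)
Definition dualA (X Y Z : C) (f : hom X (Y ⊗ Z)) : hom (dual Y ⊗ X) Z :=
  lunit Z ∘ (ev Y ⊠ idm Z) ∘ assoc_inv (dual Y) Y Z ∘ (idm (dual Y) ⊠ f).

(* Hom(X ⊗ Y, Z) -> Hom(X, Z ⊗ Y* ) *)
Definition dualB (X Y Z : C) (g : hom (X ⊗ Y) Z) : hom X (Z ⊗ dual Y) :=
  (g ⊠ idm (dual Y)) ∘ assoc_inv X Y (dual Y) ∘ (idm X ⊠ coev Y) ∘ runit_inv X.

Fixpoint tpow (V : C) (n : nat) : C :=
  if n is n'.+1 then (if n' is 0%N then V else V ⊗ tpow V n') else 1.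

(* tpow V n.+1 is V ⊗ tpow V n on the nose, except that it is V for n = 0 *)
Definition tpow_split (V : C) (n : nat) : hom (tpow V n.+1) (V ⊗ tpow V n) :=
  if n is n'.+1 then idm (V ⊗ tpow V n'.+1) else runit_inv V.

Fixpoint tpow_assoc (V : C) (n : nat) : hom (tpow V n ⊗ V) (tpow V n.+1) :=
  match n with
  | 0 => lunit V
  | n'.+1 =>
    match n' return hom (tpow V n' ⊗ V) (tpow V n'.+1) ->
                    hom (tpow V n'.+1 ⊗ V) (tpow V n'.+2) with
    | 0 => fun _ => idm (V ⊗ V)
    | n''.+1 => fun phi => (idm V ⊠ phi) ∘ assoc V (tpow V n''.+1) V
    end (tpow_assoc V n')
  end.

(* The map E_V^(n.+1).  The unit isomorphism between 1 ⊗ V* and V* ⊗ 1, left   *)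
(* implicit in "B^{1,V*}(A^1_{V,-}(f))", is spelled out.                       *)
Definition FS_map (V : C) (n : nat) (f : hom 1 (tpow V n.+1)) :
    hom 1 (tpow V n.+1) :=
  tpow_assoc V n ∘ (idm (tpow V n) ⊠ piv_inv V) ∘
    @dualB 1 (dual V) (tpow V n)
      (@dualA 1 V (tpow V n) (tpow_split V n ∘ f)
         ∘ runit_inv (dual V) ∘ lunit (dual V)).

(* Indicators are defined for n >= 1 only; the value at 0 is irrelevant. *)
Definition FS_indicator (V : C) (n : nat) : K :=
  if n is n'.+1 then lin_trace (@FS_map V n') else 0.

End Indicator.

Section Bicharacters.
Variables (R : realType) (A : finGroupType).
Local Notation C := R[i].
Implicit Types (chi : A -> A -> C) (rho f g : A -> C).

Definition bicharacter chi : Prop :=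
  [/\ forall a b, chi a b != 0,
      forall a b c, chi (a * b)%g c = chi a c * chi b c
    & forall a b c, chi a (b * c)%g = chi a b * chi a c].

Definition symmetric_bichar chi : Prop := forall a b, chi a b = chi b a.

Definition nondegenerate_bichar chi : Prop :=
  forall a, (forall x, chi x a = 1) -> a = 1%g.

(* membership in the set C(chi) *)
Definition in_C chi rho : Prop :=
  (forall a, rho a != 0) /\
  (forall a b, rho a * (rho (a * b)%g)^-1 * rho b = chi a b).

Definition fourier chi f (a : A) : C :=
  (sqrtC #|A|%:R)^-1 * \sum_x f x * (chi x a)^-1.

Definition conv f g (a : A) : C := \sum_x f x * g (x^-1 * a)%g.

(* conv_pow f 1 is f, and conv_pow f k.+1 is conv f (conv_pow f k) for k >= 1 *)
Definition conv_pow f (k : nat) : A -> C :=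
  iterop k conv f (fun a => (a == 1%g)%:R).

End Bicharacters.

Section TambaraYamagami.
Variables (R : realType) (A : finGroupType) (chi : A -> A -> R[i]) (tau : R).
Local Notation C := R[i].

(* The simple objects A ⊔ {m}: [inl a] is a, and [inr tt] is m. *)
Definition simple : finType := (A + unit)%type.

(* A finite direct sum of simple objects, presented as a finite family. *)
Record ty_ob := TYob { ty_idx : finType; ty_lab : ty_idx -> simple }.

Definition ty_simple (s : simple) : ty_ob := TYob (fun _ : unit => s).

(* Homs are matrices whose (i, j) entry lives in Hom(s_i, t_j), which is C if  *)
(* s_i = t_j and 0 otherwise; only the entries with s_i = t_j are stored.      *)
Definition ty_homidx (X Y : ty_ob) : finType :=
  {p : ty_idx X * ty_idx Y | ty_lab p.1 == ty_lab p.2}.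

Definition ty_hom (X Y : ty_ob) : vectType C := {ffun ty_homidx X Y -> C^o}.

Definition mkhom (X Y : ty_ob) (F : ty_idx X -> ty_idx Y -> C) : ty_hom X Y :=
  [ffun p => F (val p).1 (val p).2].

Definition entry (X Y : ty_ob) (f : ty_hom X Y) (i : ty_idx X) (j : ty_idx Y)
    : C :=
  if insub (i, j) is Some p then f p else 0.

Definition ty_id (X : ty_ob) : ty_hom X X := mkhom (fun i j => (i == j)%:R).

Definition ty_comp (X Y Z : ty_ob) (g : ty_hom Y Z) (f : ty_hom X Y)
    : ty_hom X Z :=
  mkhom (fun i k => \sum_j entry f i j * entry g j k).

(* [fuse s t u]: the simple u is a (multiplicity one) summand of s ⊗ t *)
Definition fuse (s t u : simple) : bool :=
  match s, t, u with
  | inl a, inl b, inl c => c == (a * b)%g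
  | inl _, inr _, inr _ => true
  | inr _, inl _, inr _ => true
  | inr _, inr _, inl _ => true
  | _, _, _ => false
  end.

(* The summands of X ⊗ Y are the triples (i, j, u) with u a summand of         *)
(* s_i ⊗ t_j.                                                                  *)
Definition ty_tens_idx (X Y : ty_ob) : finType :=
  {p : ty_idx X * ty_idx Y * simple | fuse (ty_lab p.1.1) (ty_lab p.1.2) p.2}.

Definition ty_tens (X Y : ty_ob) : ty_ob :=
  TYob (fun p : ty_tens_idx X Y => (val p).2).

Definition tfst (X Y : ty_ob) (p : ty_idx (ty_tens X Y)) : ty_idx X :=
  (val (p : ty_tens_idx X Y)).1.1.
Definition tsnd (X Y : ty_ob) (p : ty_idx (ty_tens X Y)) : ty_idx Y :=
  (val (p : ty_tens_idx X Y)).1.2.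

Definition ty_tensm (X X' Y Y' : ty_ob) (f : ty_hom X X') (g : ty_hom Y Y')
    : ty_hom (ty_tens X Y) (ty_tens X' Y') :=
  mkhom (fun p q => entry f (tfst p) (tfst q) * entry g (tsnd p) (tsnd q)).

(* The component of the associativity constraint of (s, t, r) from the summand *)
(* z of u ⊗ r, with u a summand of s ⊗ t, to the summand z of s ⊗ v, with v a  *)
(* summand of t ⊗ r.                                                           *)
Definition phi (s t r u v z : simple) : C :=
  match s, t, r with
  | inl a, inr _, inl b => chi a b
  | inr _, inl a, inr _ => if z is inl x then chi a x else 0
  | inr _, inr _, inr _ =>
      match u, v with
      | inl x, inl y => tau%:C * (chi x y)^-1
      | _, _ => 0
      end
  | _, _, _ => 1
  end.

(* The components of the inverse constraint, see [ty_assocK] and [ty_assocVK]. *)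
Definition phi_inv (s t r u v z : simple) : C :=
  match s, t, r with
  | inl a, inr _, inl b => (chi a b)^-1
  | inr _, inl a, inr _ => if z is inl x then (chi a x)^-1 else 0
  | inr _, inr _, inr _ =>
      match u, v with
      | inl x, inl y => tau%:C * chi x y
      | _, _ => 0
      end
  | _, _, _ => 1
  end.

Definition assoc_entry
    (F : simple -> simple -> simple -> simple -> simple -> simple -> C)
    (X Y Z : ty_ob) (p : ty_idx (ty_tens (ty_tens X Y) Z))
    (q : ty_idx (ty_tens X (ty_tens Y Z))) : C :=
  let i := tfst (tfst p) in let j := tsnd (tfst p) in let k := tsnd p in
  [&& tfst q == i, tfst (tsnd q) == j & tsnd (tsnd q) == k]%:R
    * F (ty_lab i) (ty_lab j) (ty_lab k)
        (ty_lab (tfst p)) (ty_lab (tsnd q)) (ty_lab p).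

Definition ty_assoc (X Y Z : ty_ob)
    : ty_hom (ty_tens (ty_tens X Y) Z) (ty_tens X (ty_tens Y Z)) :=
  mkhom (fun p q => assoc_entry phi p q).

Definition ty_assoc_inv (X Y Z : ty_ob)
    : ty_hom (ty_tens X (ty_tens Y Z)) (ty_tens (ty_tens X Y) Z) :=
  mkhom (fun q p => assoc_entry phi_inv p q).

Definition ty_unit : ty_ob := ty_simple (inl 1%g).

Definition ty_lunit (X : ty_ob) : ty_hom (ty_tens ty_unit X) X :=
  mkhom (fun p i => (tsnd p == i)%:R).
Definition ty_lunit_inv (X : ty_ob) : ty_hom X (ty_tens ty_unit X) :=
  mkhom (fun i p => (tsnd p == i)%:R).
Definition ty_runit (X : ty_ob) : ty_hom (ty_tens X ty_unit) X :=
  mkhom (fun p i => (tfst p == i)%:R).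
Definition ty_runit_inv (X : ty_ob) : ty_hom X (ty_tens X ty_unit) :=
  mkhom (fun i p => (tfst p == i)%:R).

Definition sdual (s : simple) : simple :=
  if s is inl a then inl (a^-1)%g else s.

Definition ty_dual (X : ty_ob) : ty_ob := TYob (fun i => sdual (@ty_lab X i)).

Definition ty_coev (X : ty_ob) : ty_hom ty_unit (ty_tens X (ty_dual X)) :=
  mkhom (fun _ (p : ty_idx (ty_tens X (ty_dual X))) =>
           (tfst p == tsnd p :> ty_idx X)%:R).

Definition ty_ev (X : ty_ob) : ty_hom (ty_tens (ty_dual X) X) ty_unit :=
  mkhom (fun (p : ty_idx (ty_tens (ty_dual X) X)) _ =>
           (tfst p == tsnd p :> ty_idx X)%:R
                    * (if ty_lab (tsnd p : ty_idx X) is inl _ then 1 else (tau%:C)^-1)).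

Definition ty_piv (X : ty_ob) : ty_hom X (ty_dual (ty_dual X)) :=
  mkhom (fun (i : ty_idx X) (j : ty_idx (ty_dual (ty_dual X))) =>
           (i == j :> ty_idx X)%:R
           * (if ty_lab i is inl _ then 1 else (Num.sg tau)%:C)).
Definition ty_piv_inv (X : ty_ob) : ty_hom (ty_dual (ty_dual X)) X :=
  mkhom (fun (i : ty_idx (ty_dual (ty_dual X))) (j : ty_idx X) =>
           (i == j :> ty_idx X)%:R
           * (if ty_lab j is inl _ then 1 else ((Num.sg tau)%:C)^-1)).

Definition TY : pivotal_data C :=
  @PivotalData C ty_ob ty_hom ty_id ty_comp ty_tens ty_tensm ty_unit
    ty_assoc ty_assoc_inv ty_lunit ty_lunit_inv ty_runit ty_runit_inv
    ty_dual ty_coev ty_ev ty_piv ty_piv_inv.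

Definition TYm : TY := ty_simple (inr tt).

End TambaraYamagami.

(* [phi_inv] does give the inverse of the associativity constraint.             *)
Section AssocInverse.
Variables (R : realType) (A : finGroupType) (chi : A -> A -> R[i]) (tau : R).
Hypotheses (chiM : bicharacter chi) (chiC : symmetric_bichar chi)
  (chi_nd : nondegenerate_bichar chi) (tau2 : tau ^+ 2 = #|A|%:R^-1).
Local Notation C := R[i].
Local Notation ty_ob := (ty_ob A).

Lemma entry_mkhom (X Y : ty_ob) (F : ty_idx X -> ty_idx Y -> C) i j :
  entry (mkhom F) i j = if ty_lab i == ty_lab j then F i j else 0.
Proof.
rewrite /entry; case: insubP => [p|] /=; last by move/negbTE->.
by move=> h e; rewrite h ffunE (e : val p = (i, j)).
Qed.

Lemma ty_hom_ext (X Y : ty_ob) (f g : ty_hom R X Y) :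
  (forall i j, ty_lab i = ty_lab j -> entry f i j = entry g i j) -> f = g.
Proof.
move=> fg; apply/ffunP => p; case: p => -[i j] /= e.
by have := fg i j (eqP e); rewrite /entry insubT.
Qed.

Lemma chi_sum (c : A) : \sum_x chi c x = if c == 1%g then #|A|%:R else 0.
Proof.
have [chi0 chil chir] := chiM.
have chi1x x : chi 1%g x = 1.
  by apply: (mulfI (chi0 1%g x)); rewrite -chil mulg1 mulr1.
case: eqP => [->|c1]; first by rewrite (eq_bigr _ (fun x _ => chi1x x)) sumr_const.
have [/forallP h|/forallPn[b cb]] := boolP [forall b, chi c b == 1].
  by case: c1; apply: chi_nd => x; rewrite chiC; apply/eqP.
have : (chi c b - 1) * (\sum_x chi c x) = 0.
  rewrite mulrBl mul1r [X in _ - X](reindex_inj (mulgI b)) /= mulr_sumr.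
  by apply/eqP; rewrite subr_eq0; apply/eqP/eq_bigr => x _; rewrite chir.
by move/eqP; rewrite mulf_eq0 subr_eq0 (negbTE cb) => /eqP.
Qed.

Lemma chi_orth (x y : A) :
  \sum_v (tau%:C * (chi x v)^-1) * (tau%:C * chi y v) = (x == y)%:R.
Proof.
have [chi0 chil chir] := chiM.
transitivity (\sum_v tau%:C ^+ 2 * chi (x^-1 * y)%g v).
  apply: eq_bigr => v _; rewrite mulrACA -expr2; congr (_ * _).
  apply: (mulfI (chi0 x v)); rewrite mulrA divff // mul1r -chil.
  by rewrite mulgA mulgV mul1g.
rewrite -mulr_sumr chi_sum -eq_mulVg1; case: eqP => _; last by rewrite mulr0.
rewrite -rmorphXn /= tau2 fmorphV rmorph_nat mulVf // pnatr_eq0 -lt0n.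
by apply/card_gt0P; exists 1%g.
Qed.

Lemma sum_simple (P : pred (simple A)) (F : simple A -> C) :
  \sum_(v | P v) F v =
    \sum_(a | P (inl a)) F (inl a) + (if P (inr tt) then F (inr tt) else 0).
Proof.
rewrite big_sumType /=; congr (_ + _).
by rewrite big_mkcond /= (big_pred1 tt) // => -[].
Qed.

Lemma phiK (s t r u u' z : simple A) :
  fuse s t u -> fuse s t u' -> fuse u r z -> fuse u' r z ->
  \sum_(v | fuse t r v && fuse s v z) phi chi tau s t r u v z *
    phi_inv chi tau s t r u' v z = (u == u')%:R.
Proof.
have [chi0 _ _] := chiM.
rewrite sum_simple.
case: s t r u u' z => [a|[]] [b|[]] [c|[]] [x|[]] [y|[]] [z|[]] //=.
- move=> /eqP-> /eqP-> /eqP-> _; rewrite eqxx addr0.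
  rewrite (big_pred1 (b * c)%g) ?mulr1 // => v.
  by rewrite !inE /=; case: eqP => // ->; rewrite mulgA eqxx.
- by move=> /eqP-> /eqP-> _ _; rewrite eqxx big_pred0_eq add0r mulr1.
- by move=> *; rewrite big_pred0_eq add0r divff.
- move=> *; rewrite addr0 (big_pred1 (a^-1 * z)%g) ?mulr1 // => v.
  by rewrite eq_sym -(inj_eq (mulgI a^-1%g)) mulKg.
- move=> *; rewrite addr0 (big_pred1 (b * c)%g) ?mulr1 // => v.
  by rewrite andbT.
- by move=> *; rewrite big_pred0_eq add0r divff.
- move=> _ _ /eqP-> /eqP/mulIg->.
  by rewrite big_pred0_eq add0r mulr1 eqxx.
- by move=> *; rewrite addr0 chi_orth.
Qed.

Lemma phiVK (s t r v v' z : simple A) :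
  fuse t r v -> fuse t r v' -> fuse s v z -> fuse s v' z ->
  \sum_(u | fuse s t u && fuse u r z) phi_inv chi tau s t r u v z *
    phi chi tau s t r u v' z = (v == v')%:R.
Proof.
have [chi0 _ _] := chiM.
rewrite sum_simple.
case: s t r v v' z => [a|[]] [b|[]] [c|[]] [x|[]] [y|[]] [z|[]] //=.
- move=> /eqP-> /eqP-> /eqP-> _; rewrite eqxx addr0.
  rewrite (big_pred1 (a * b)%g) ?mulr1 // => v.
  by rewrite !inE /=; case: eqP => // ->; rewrite mulgA eqxx.
- move=> *; rewrite addr0 (big_pred1 (a * b)%g) ?mulr1 // => v.
  by rewrite andbT.
- by move=> *; rewrite big_pred0_eq add0r mulVf.
- by move=> _ _ /eqP-> /eqP/mulgI->; rewrite big_pred0_eq add0r mulr1 eqxx.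
- by move=> /eqP-> /eqP-> *; rewrite big_pred0_eq add0r mulr1 eqxx.
- by move=> *; rewrite big_pred0_eq add0r mulVf.
- move=> *; rewrite addr0 (big_pred1 (z * c^-1)%g) ?mulr1 // => v.
  by rewrite eq_sym -(inj_eq (mulIg c^-1%g)) mulgK.
- move=> *; rewrite addr0 -[(inl x == inl y)]/(x == y) eq_sym -chi_orth.
  by apply: eq_bigr => v _; rewrite mulrC [chi v x]chiC [chi v y]chiC.
Qed.

Lemma tens_idx_eq (X Y : ty_ob) (p q : ty_idx (ty_tens X Y)) :
  (p == q) = [&& tfst p == tfst q, tsnd p == tsnd q & ty_lab p == ty_lab q].
Proof.
rewrite -(inj_eq val_inj) /= /tfst /tsnd /=.
by case: p q => -[[a b] c] /= _ [[[a' b'] c'] /= _]; rewrite !xpair_eqE -andbA.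
Qed.

Lemma fuse_lab (X Y : ty_ob) (p : ty_idx (ty_tens X Y)) :
  fuse (ty_lab (tfst p)) (ty_lab (tsnd p)) (ty_lab p).
Proof. exact: (valP (p : ty_tens_idx X Y)). Qed.

Lemma tens_idx_mk (X Y : ty_ob) i j u : fuse (ty_lab i) (ty_lab j) u ->
  {p : ty_idx (ty_tens X Y) | [/\ tfst p = i, tsnd p = j & ty_lab p = u]}.
Proof.
by move=> h; exists (exist _ (i, j, u) h : ty_tens_idx X Y).
Qed.

(* sums over the summands of X ⊗ (Y ⊗ Z) with prescribed i, j, k and label z *)
Lemma sum_tens_r (X Y Z : ty_ob) i j k z (F : simple A -> C) :
  \sum_(q : ty_idx (ty_tens X (ty_tens Y Z)) |
      [&& tfst q == i, tfst (tsnd q) == j, tsnd (tsnd q) == k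
        & ty_lab q == z]) F (ty_lab (tsnd q)) =
  \sum_(v | fuse (ty_lab j) (ty_lab k) v && fuse (ty_lab i) v z) F v.
Proof.
rewrite (partition_big (fun q : ty_idx (ty_tens X (ty_tens Y Z)) => ty_lab (tsnd q))
   (fun v => fuse (ty_lab j) (ty_lab k) v && fuse (ty_lab i) v z)).
  apply: eq_bigr => v /andP[h1 h2].
  have [r [r1 r2 r3]] := tens_idx_mk h1.
  rewrite -r3 in h2; have [q [q1 q2 q3]] := tens_idx_mk h2.
  rewrite (big_pred1 q) ?q2 ?r3 // => q'.
  rewrite -[RHS]/(q' == q) !tens_idx_eq q1 q2 q3 r1 r2 r3 -!andbA.
  by do 3 congr (_ && _); rewrite andbC.
move=> q /and4P[/eqP<- /eqP<- /eqP<- /eqP<-].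
by rewrite fuse_lab (fuse_lab q).
Qed.

Lemma sum_tens_l (X Y Z : ty_ob) i j k z (F : simple A -> C) :
  \sum_(p : ty_idx (ty_tens (ty_tens X Y) Z) |
      [&& tfst (tfst p) == i, tsnd (tfst p) == j, tsnd p == k
        & ty_lab p == z]) F (ty_lab (tfst p)) =
  \sum_(u | fuse (ty_lab i) (ty_lab j) u && fuse u (ty_lab k) z) F u.
Proof.
rewrite (partition_big (fun p : ty_idx (ty_tens (ty_tens X Y) Z) => ty_lab (tfst p))
   (fun u => fuse (ty_lab i) (ty_lab j) u && fuse u (ty_lab k) z)).
  apply: eq_bigr => u /andP[h1 h2].
  have [r [r1 r2 r3]] := tens_idx_mk h1.
  rewrite -r3 in h2; have [q [q1 q2 q3]] := tens_idx_mk h2.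
  rewrite (big_pred1 q) ?q1 ?r3 // => q'.
  rewrite -[RHS]/(q' == q) !tens_idx_eq q1 q2 q3 r1 r2 r3 -!andbA.
  do 2 congr (_ && _).
  by rewrite andbA andbC.
move=> q /and4P[/eqP<- /eqP<- /eqP<- /eqP<-].
by rewrite fuse_lab (fuse_lab q).
Qed.

Lemma ty_assocK (X Y Z : ty_ob) :
  ty_comp (ty_assoc_inv chi tau X Y Z) (ty_assoc chi tau X Y Z) = ty_id R _.
Proof.
apply: ty_hom_ext => p p' e; rewrite !entry_mkhom e eqxx.
under eq_bigr => q _ do rewrite !entry_mkhom /assoc_entry.
have [/and3P[/eqP e1 /eqP e2 /eqP e3]|ne] := boolP
  [&& tfst (tfst p) == tfst (tfst p'), tsnd (tfst p) == tsnd (tfst p')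
    & tsnd p == tsnd p']; last first.
  rewrite big1 => [|q _].
    rewrite !tens_idx_eq -!andbA.
    by move: ne; do 3 ?[case: eqP => //= _]; rewrite ?andbF.
  case: ifP => _; rewrite ?mul0r //; case: ifP => _; rewrite ?mulr0 //.
  case: and3P => [[/eqP-> /eqP-> /eqP->]|_]; last by rewrite !mul0r.
  by rewrite (negbTE ne) mul0r mulr0.
have h := fuse_lab (tfst p); have h' := fuse_lab (tfst p').
have g := fuse_lab p; have g' := fuse_lab p'.
rewrite -e1 -e2 in h'; rewrite -e3 -e in g'.
have -> : (p == p') = (ty_lab (tfst p) == ty_lab (tfst p')).
  by rewrite !tens_idx_eq e1 e2 e3 e !eqxx !andbT.
rewrite -(phiK h h' g g') -sum_tens_r [in RHS]big_mkcond.
apply: eq_bigr => q _.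
rewrite -e1 -e2 -e3 -e eq_sym [_ == ty_lab p]eq_sym.
case: eqP => [_|_]; last by rewrite !andbF mul0r.
by rewrite andbT; case: ifP => _; rewrite ?mul1r // !mul0r.
Qed.

Lemma ty_assocVK (X Y Z : ty_ob) :
  ty_comp (ty_assoc chi tau X Y Z) (ty_assoc_inv chi tau X Y Z) = ty_id R _.
Proof.
apply: ty_hom_ext => q q' e; rewrite !entry_mkhom e eqxx.
under eq_bigr => p _ do rewrite !entry_mkhom /assoc_entry.
have [/and3P[/eqP e1 /eqP e2 /eqP e3]|ne] := boolP
  [&& tfst q' == tfst q, tfst (tsnd q') == tfst (tsnd q)
    & tsnd (tsnd q') == tsnd (tsnd q)]; last first.
  rewrite big1 => [|p _].
    rewrite [q == _]eq_sym !tens_idx_eq -!andbA.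
    by move: ne; do 3 ?[case: eqP => //= _]; rewrite ?andbF.
  case: ifP => _; rewrite ?mul0r //; case: ifP => _; rewrite ?mulr0 //.
  case: and3P => [[/eqP<- /eqP<- /eqP<-]|_]; last by rewrite !mul0r.
  by rewrite (negbTE ne) mul0r mulr0.
have h := fuse_lab (tsnd q); have h' := fuse_lab (tsnd q').
have g := fuse_lab q; have g' := fuse_lab q'.
rewrite e2 e3 in h'; rewrite e1 -e in g'.
have -> : (q == q') = (ty_lab (tsnd q) == ty_lab (tsnd q')).
  by rewrite !tens_idx_eq e1 e2 e3 e !eqxx !andbT.
rewrite -(phiVK h h' g g') -sum_tens_l [in RHS]big_mkcond.
apply: eq_bigr => p _.
rewrite e1 e2 e3 -e [ty_lab q == _]eq_sym ![_ (tfst p) == _]eq_sym.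
rewrite [tsnd p == _]eq_sym.
case: eqP => [ep|_]; last by rewrite !andbF mul0r.
rewrite andbT; case: and3P => [[/eqP-> /eqP-> /eqP->]|_]; last by rewrite !mul0r.
by rewrite ep !mul1r.
Qed.
End AssocInverse.

(* Main.v *)
Require Import Defs.
From HB Require Import structures.
From mathcomp Require Import all_boot all_order all_algebra all_fingroup.
From mathcomp Require Import complex.
From mathcomp Require Import reals.
From mathcomp Require Import ring.

Set Implicit Arguments.
Unset Strict Implicit.
Unset Printing Implicit Defensive.

Import Order.TTheory GRing.Theory Num.Theory.
Local Open Scope ring_scope.
Local Open Scope complex_scope.

(** The space Hom(1, m^n) has a basis indexed by the summands with label 1 of
    the right-nested tensor power m ⊗ (m ⊗ ...).  The summands of an odd power
    of m are all m, and those of an even power lie in A.  Hence Hom(1, m^n) = 0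
    for n odd ([FS_indicator_odd]), while for n = 2k a basis element is the
    sequence (a_1, ..., a_(k-1)) of its labels in the inner even powers.

    The automorphism E^(n) moves the first factor m to the end.  In the two
    duality steps the scalar tau of the constraint for (m, m, m) cancels the
    scalar tau^-1 of the evaluation, and the pivotal structure contributes
    sgn(tau)^-1.  What remains is the rebracketing m^(n-1) ⊗ m -> m^n, whose
    entries are products of the scalars tau chi(a, b)^-1 and chi(a, b)
    ([slice_step], [entry_rotate]).  On the diagonal,

      nu_2k(m) = sgn(tau)^-1 tau^(k-1)
          sum over (a_i) of prod_i chi(a_i, a_i)^-1 chi(a_i, a_(i+1)),

    the product running over i < k, with a_k = 1.  This sum is computed one
    a_i at a time, keeping the label z of the outermost summand free
    ([diag_slice_step]).  For rho in C(chi),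

      rho (z a^-1) = rho z (rho a)^-1 chi(a, z) chi(a, a)^-1   ([in_C_div]),

    so each step of the recursion is, up to the factors rho, a convolution
    with rho, and the sum for the label z equals tau^(k-1) rho^*k(z) / rho z
    ([diag_slice_tpow]).  At z = 1 this is the second formula, because
    tau = sgn(tau) / sqrt |A|.  The first formula is equal to it by Fourier
    inversion: the transform turns convolution into a product, and summing
    chi(x, a)^-1 over a singles out x = 1 ([sum_fourier]). *)

(** * Traces of linear maps *)

(** The trace of an endomorphism given by a matrix in the coordinates of a
    function space is the sum of the diagonal entries. *)
Lemma lin_trace_ffun (K : fieldType) (I : finType)
    (f : {ffun I -> K^o} -> {ffun I -> K^o}) (M : I -> I -> K) :
  (forall v q, f v q = \sum_p v p * M p q) -> lin_trace f = \sum_p M p p.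
Proof.
move=> fM; rewrite /lin_trace; set b := vbasis _.
(* the canonical basis of the function space *)
pose d p : {ffun I -> K^o} := [ffun q => (q == p)%:R].
have dE (v : {ffun I -> K^o}) : v = \sum_p v p *: d p.
  apply/ffunP => q; rewrite sum_ffunE (bigD1 q) //= big1 ?addr0 => [|p pq].
    by rewrite !ffunE eqxx /GRing.scale /= mulr1.
  by rewrite !ffunE eq_sym (negbTE pq) scaler0.
under eq_bigr => j _ do rewrite [f _]dE linear_sum /=.
rewrite exchange_big /=; apply: eq_bigr => q _.
under eq_bigr => j _ do rewrite linearZ /= fM mulr_suml.
rewrite exchange_big /= (bigD1 q) //= [X in _ + X]big1 ?addr0 => [|p pq].
  transitivity (M q q * (\sum_j coord b j (d q) *: b`_j) q).
    rewrite sum_ffunE mulr_sumr; apply: eq_bigr => j _.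
    rewrite ffunE /GRing.scale /= mulrA [RHS]mulrC mulrA mulrAC mulrC.
    by rewrite mulrA.
  by rewrite -coord_vbasis ?memvf // ffunE eqxx mulr1.
transitivity (M p q * (\sum_j coord b j (d q) *: b`_j) p).
  rewrite sum_ffunE mulr_sumr; apply: eq_bigr => j _.
  by rewrite ffunE /GRing.scale /=; rewrite mulrA [RHS]mulrC mulrA mulrAC mulrC mulrA.
by rewrite -coord_vbasis ?memvf // ffunE (negbTE pq) mulr0.
Qed.

Lemma lin_trace_trivial (K : fieldType) (V : vectType K) (f : V -> V) :
  (forall v : V, v = 0) -> lin_trace f = 0.
Proof. by move=> V0; apply: big1 => i _; rewrite [f _]V0 linear0. Qed.

Lemma eq_lin_trace (K : fieldType) (V : vectType K) (f g : V -> V) :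
  f =1 g -> lin_trace f = lin_trace g.
Proof. by move=> fg; apply: eq_bigr => i _; rewrite fg. Qed.

(** * Bicharacters, Fourier transform and convolution *)

Section Fourier.
Variables (R : realType) (A : finGroupType) (chi : A -> A -> R[i]).
Hypotheses (chiM : bicharacter chi) (chiC : symmetric_bichar chi)
  (chi_nd : nondegenerate_bichar chi).

Let chi0 a b : chi a b != 0. Proof. by case: chiM. Qed.
Let chiMl a b c : chi (a * b)%g c = chi a c * chi b c.
Proof. by case: chiM. Qed.

Lemma bichar1l c : chi 1%g c = 1.
Proof. by apply: (mulfI (chi0 1%g c)); rewrite -chiMl mulg1 mulr1. Qed.

Lemma bicharVl a c : chi a^-1%g c = (chi a c)^-1.
Proof.
by apply: (mulfI (chi0 a c)); rewrite -chiMl mulgV bichar1l mulfV.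
Qed.

Lemma conv_powS (f : A -> R[i]) k : conv_pow f k.+2 = conv f (conv_pow f k.+1).
Proof. by []. Qed.

(** Up to normalisation, the Fourier transform of a convolution power is a
    power of the Fourier transform. *)
Lemma fourier_conv_pow (f : A -> R[i]) k a :
  \sum_x conv_pow f k.+1 x * (chi x a)^-1
    = (\sum_x f x * (chi x a)^-1) ^+ k.+1.
Proof.
elim: k => [//|k IH]; rewrite exprS -IH conv_powS /conv mulr_suml.
under eq_bigr => x _ do rewrite mulr_suml.
rewrite exchange_big; apply: eq_bigr => y _ /=; rewrite mulr_sumr.
rewrite (reindex_inj (mulgI y)) /=; apply: eq_bigr => x _.
by rewrite mulKg chiMl invfM mulrACA.
Qed.

Lemma sum_fourier (f : A -> R[i]) k :
  \sum_a fourier chi f a ^+ k.+1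
    = (sqrtC #|A|%:R) ^- k.+1 * (#|A|%:R * conv_pow f k.+1 1%g).
Proof.
under eq_bigr => a _ do rewrite /fourier exprMn -fourier_conv_pow exprVn.
rewrite -mulr_sumr exchange_big /=; congr (_ * _).
have sV x : \sum_a (chi x a)^-1 = if x == 1%g then #|A|%:R else 0.
  under eq_bigr => a _ do rewrite -bicharVl.
  by rewrite (chi_sum chiM chiC chi_nd) invg_eq1.
under eq_bigr => x _ do rewrite -mulr_sumr sV.
rewrite (bigD1 1%g) //= eqxx mulrC big1 ?addr0 // => x /negbTE->.
by rewrite mulr0.
Qed.

Variable rho : A -> R[i].
Hypothesis rhoC : in_C chi rho.

Lemma in_C1 : rho 1%g = 1.
Proof.
have [r0 /(_ 1%g 1%g)] := rhoC.
by rewrite mulg1 mulfV // mul1r bichar1l.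
Qed.

(** The functions of C(chi) are quadratic: this identity lets the diagonal
    entries of the rotation matrix telescope. *)
Lemma in_C_div z a : rho (z * a^-1)%g = rho z * (rho a)^-1 * chi a z / chi a a.
Proof.
have [r0 rM] := rhoC.
have := rM (z * a^-1)%g a; rewrite mulgKV chiMl bicharVl [chi z a]chiC.
move=> h; rewrite -mulrA -h mulrACA mulVf // mulr1 [RHS]mulrCA.
by rewrite mulfV // mulr1.
Qed.
End Fourier.

(** * Morphisms as matrices *)

(** The index set of a simple object is the unit type. *)
Lemma unit_irr (x y : unit) : x = y. Proof. by case: x y => -[]. Qed.

Lemma natb_neq0 (K : pzSemiRingType) (b : bool) : b%:R != 0 :> K -> b.
Proof. by case: b => //; rewrite mulr0n eqxx. Qed.

Section Entries.
Variables (R : realType) (A : finGroupType).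
Local Notation ty_ob := (ty_ob A).

Lemma entry_neq0_lab (X Y : ty_ob) (f : ty_hom R X Y) i j :
  entry f i j != 0 -> ty_lab i = ty_lab j.
Proof.
by apply: contra_neq_eq => ne; rewrite /entry insubF //=; apply/negbTE.
Qed.

Lemma entry_val (X Y : ty_ob) (f : ty_hom R X Y) (p : ty_homidx X Y) :
  entry f (val p).1 (val p).2 = f p.
Proof. by rewrite /entry -surjective_pairing valK. Qed.

Lemma entry_mkhom_lab (X Y : ty_ob) (F : ty_idx X -> ty_idx Y -> R[i]) i j :
  ty_lab i = ty_lab j -> entry (mkhom F) i j = F i j.
Proof. by move=> ij; rewrite entry_mkhom ij eqxx. Qed.

Lemma entry_mkhom_neq0 (X Y : ty_ob) (F : ty_idx X -> ty_idx Y -> R[i]) i j :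
  entry (mkhom F) i j != 0 -> F i j != 0.
Proof. by rewrite entry_mkhom; case: ifP; rewrite ?eqxx. Qed.

Lemma entry_comp (X Y Z : ty_ob) (g : ty_hom R Y Z) (f : ty_hom R X Y) i k :
  entry (ty_comp g f) i k = \sum_j entry f i j * entry g j k.
Proof.
rewrite entry_mkhom; case: eqP => // ik; rewrite big1 // => j _.
apply: contra_not_eq ik; rewrite mulf_eq0 negb_or => /andP[fij gjk].
by rewrite (entry_neq0_lab fij) (entry_neq0_lab gjk).
Qed.

(** If only the summand [j0] of the middle object contributes, an entry of a
    composite is a product of two entries. *)
Lemma entry_comp_only (X Y Z : ty_ob) (g : ty_hom R Y Z) (f : ty_hom R X Y)
    i j0 k :
  (forall j, entry f i j != 0 -> entry g j k != 0 -> j = j0) ->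
  entry (ty_comp g f) i k = entry f i j0 * entry g j0 k.
Proof.
move=> only; rewrite entry_comp (big_only1 j0) // => j ne _.
apply: contraNeq ne; rewrite mulf_eq0 negb_or => /andP[fij gjk].
by apply/eqP/only.
Qed.

Lemma entry_id (X : ty_ob) i j : entry (ty_id R X) i j = (i == j)%:R.
Proof.
rewrite entry_mkhom; case: eqP => // ij; case: eqP => // eij.
by case: ij; rewrite eij.
Qed.

Lemma entry_id_neq0 (X : ty_ob) i j : entry (ty_id R X) i j != 0 -> i = j.
Proof. by rewrite entry_id; case: (i =P j) => // _; rewrite mulr0n eqxx. Qed.

Lemma ty_comp1f (X Y : ty_ob) (f : ty_hom R X Y) : ty_comp (ty_id R Y) f = f.
Proof.
apply: ty_hom_ext => i j _; rewrite (@entry_comp_only _ _ _ _ _ _ j).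
  by rewrite entry_id eqxx mulr1.
by move=> k _ /entry_id_neq0.
Qed.

(** A summand of a tensor product is determined by its two factors and its
    label. *)
Lemma tens_idx_inj (X Y : ty_ob) (p q : ty_idx (ty_tens X Y)) :
  tfst p = tfst q -> tsnd p = tsnd q -> ty_lab p = ty_lab q -> p = q.
Proof. by move=> e1 e2 e3; apply/eqP; rewrite tens_idx_eq e1 e2 e3 !eqxx. Qed.

Lemma entry_tensm_lab (X X' Y Y' : ty_ob) (f : ty_hom R X X')
    (g : ty_hom R Y Y') p q : ty_lab p = ty_lab q ->
  entry (ty_tensm f g) p q
    = entry f (tfst p) (tfst q) * entry g (tsnd p) (tsnd q).
Proof. exact: entry_mkhom_lab. Qed.

Lemma entry_tensm_neq0 (X X' Y Y' : ty_ob) (f : ty_hom R X X')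
    (g : ty_hom R Y Y') p q : entry (ty_tensm f g) p q != 0 ->
  entry f (tfst p) (tfst q) != 0 /\ entry g (tsnd p) (tsnd q) != 0.
Proof. by move/entry_mkhom_neq0; rewrite mulf_eq0 negb_or => /andP. Qed.

Lemma assoc_entry_eq F (X Y Z : ty_ob) (p : ty_idx (ty_tens (ty_tens X Y) Z))
    (q : ty_idx (ty_tens X (ty_tens Y Z))) :
  tfst q = tfst (tfst p) -> tfst (tsnd q) = tsnd (tfst p) ->
  tsnd (tsnd q) = tsnd p ->
  @assoc_entry R A F X Y Z p q = F (ty_lab (tfst (tfst p)))
    (ty_lab (tsnd (tfst p))) (ty_lab (tsnd p)) (ty_lab (tfst p))
    (ty_lab (tsnd q)) (ty_lab p).
Proof. by move=> e1 e2 e3; rewrite /assoc_entry e1 e2 e3 !eqxx mul1r. Qed.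

Lemma assoc_entry_neq0 F (X Y Z : ty_ob) (p : ty_idx (ty_tens (ty_tens X Y) Z))
    (q : ty_idx (ty_tens X (ty_tens Y Z))) :
  @assoc_entry R A F X Y Z p q != 0 ->
  [/\ tfst q = tfst (tfst p), tfst (tsnd q) = tsnd (tfst p)
    & tsnd (tsnd q) = tsnd p].
Proof.
rewrite /assoc_entry; case: and3P; last by rewrite mul0r eqxx.
by case=> /eqP-> /eqP-> /eqP->.
Qed.
End Entries.

(** * Slices of the associativity constraint *)

Section CyclicRotation.
Variables (R : realType) (A : finGroupType) (chi : A -> A -> R[i]) (tau : R).
Hypotheses (chiM : bicharacter chi) (tau_neq0 : tau != 0).
Local Notation C := R[i].
Local Notation ty_ob := (ty_ob A).
Local Notation e := (inl 1%g : simple A).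
Local Notation m := (inr tt : simple A).
Local Notation M := (ty_simple m : ty_ob).
Local Notation phi := (phi chi tau).

(** The entries of [psi : T ⊗ m -> U] from the summands of q ⊗ m to r.  At most
    one summand s of q ⊗ m has the label of r; [slice psi q r] is the entry of
    [psi] from s to r, or 0 if there is no such s. *)
Definition slice (T U : ty_ob) (psi : ty_hom R (ty_tens T M) U)
    (q : ty_idx T) (r : ty_idx U) : C :=
  \sum_(s : ty_idx (ty_tens T M) | tfst s == q) entry psi s r.

(** The morphism (m ⊗ T) ⊗ m -> m ⊗ (T ⊗ m) -> m ⊗ U: the recursion step of
    the rebracketing m^n ⊗ m -> m^(n+1). *)
Definition assoc_step (T U : ty_ob) (psi : ty_hom R (ty_tens T M) U) :
    ty_hom R (ty_tens (ty_tens M T) M) (ty_tens M U) :=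
  ty_comp (ty_tensm (ty_id R M) psi) (ty_assoc chi tau M T M).

Lemma slice_only (T U : ty_ob) (psi : ty_hom R (ty_tens T M) U)
    (s : ty_idx (ty_tens T M)) r : ty_lab s = ty_lab r ->
  slice psi (tfst s) r = entry psi s r.
Proof.
move=> sr; rewrite /slice (big_only1 s) // => s' ne /eqP s's.
apply: contraNeq ne => /entry_neq0_lab s'r; apply/eqP/tens_idx_inj => //.
  exact: unit_irr.
by rewrite s'r sr.
Qed.

Lemma slice_id q r : slice (ty_id R (ty_tens M M)) q r = 1.
Proof.
have -> : q = tfst r by exact: unit_irr.
by rewrite slice_only // entry_id eqxx.
Qed.

Lemma slice_eq0 (T U : ty_ob) (psi : ty_hom R (ty_tens T M) U) q r :
  ~~ fuse (ty_lab q) m (ty_lab r) -> slice psi q r = 0.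
Proof.
move=> nf; rewrite /slice big1 // => s /eqP sq; apply: contraNeq nf.
by move=> /entry_neq0_lab <-; rewrite -sq; apply: fuse_lab.
Qed.

(** Each recursion step multiplies the entries by one scalar of the
    associativity constraint. *)
Lemma slice_step (T U : ty_ob) (psi : ty_hom R (ty_tens T M) U)
    (q : ty_idx (ty_tens M T)) (r : ty_idx (ty_tens M U)) :
  fuse (ty_lab q) m (ty_lab r) ->
  slice (assoc_step psi) q r =
    phi m (ty_lab (tsnd q)) m (ty_lab q) (ty_lab (tsnd r)) (ty_lab r)
      * slice psi (tsnd q) (tsnd r).
Proof.
move=> hf; have [s [s1 _ s3]] := @tens_idx_mk A (ty_tens M T) M q tt _ hf.
rewrite -[in LHS]s1 slice_only // /assoc_step.
(* if (tsnd q) ⊗ m has no summand with the label of (tsnd r), both sides are 0 *)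
have [hf'|hf'] := boolP (fuse (ty_lab (tsnd q)) m (ty_lab (tsnd r)));
    last first.
  rewrite (slice_eq0 _ hf') mulr0 entry_comp big1 // => w _.
  apply: contraNeq hf'; rewrite mulf_eq0 negb_or => /andP[].
  move=> /entry_mkhom_neq0/assoc_entry_neq0[_ w2 _] /entry_tensm_neq0[_].
  by move=> /entry_neq0_lab <-; rewrite -s1 -w2; apply: fuse_lab.
(* otherwise the only contribution is from the summand w = m ⊗ v *)
have [v [v1 v2 v3]] := @tens_idx_mk A T M (tsnd q) tt _ hf'.
have hw : fuse m (ty_lab v) (ty_lab r) by rewrite v3; exact: (fuse_lab r).
have [w [w1 w2 w3]] := @tens_idx_mk A M (ty_tens T M) tt v _ hw.
rewrite (@entry_comp_only _ _ _ _ _ _ _ _ w) => [|w'].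
  rewrite entry_tensm_lab // entry_id w2 -v1 slice_only //.
  have -> : tfst w == tfst r by apply/eqP/unit_irr.
  rewrite mul1r entry_mkhom_lab ?w3 ?s3 //; congr (_ * _).
  rewrite assoc_entry_eq ?w2 ?v1 ?v2 ?v3 ?s1 ?s3 //.
    exact: unit_irr.
  by case: (tsnd s).
move=> /entry_mkhom_neq0/assoc_entry_neq0[_ w2' _] w'r.
have /entry_tensm_neq0[_ /entry_neq0_lab w'v] := w'r.
have w'l := entry_neq0_lab w'r.
apply: tens_idx_inj; rewrite ?w3 //.
  exact: unit_irr.
rewrite w2; apply: tens_idx_inj; rewrite ?v1 ?v2 ?v3 ?w2' ?s1 //.
by case: (tsnd _).
Qed.

(** * The diagonal sum of the rotation *)

(** The sum of the diagonal entries of the rotation by [psi], over the summands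
    of m ⊗ T with label [z].  The trace of the rotation of Hom(1, m ⊗ T) only
    needs z = 1, but the recursion needs every label. *)
Definition diag_slice (T : ty_ob) (psi : ty_hom R (ty_tens T M) (ty_tens M T))
    (z : simple A) : C :=
  \sum_(r : ty_idx (ty_tens M T) | ty_lab r == z) slice psi (tsnd r) r.

Lemma diag_slice_id (z : A) :
  diag_slice (ty_id R (ty_tens M M)) (inl z) = 1.
Proof.
have [r [_ _ r3]] := @tens_idx_mk A M M tt tt (inl z) isT.
rewrite /diag_slice (big_only1 r) ?r3 ?slice_id // => r' ne /eqP r'3.
case/eqP: ne; apply: tens_idx_inj; last by rewrite r3.
  exact: unit_irr.
exact: unit_irr.
Qed.

(** Two more tensor factors m add the summation over one element [a] of A: the
    step m, m, m contributes tau chi(a, a)^-1 and the step m, a, m contributes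
    chi(a, z). *)
Lemma diag_slice_step (T : ty_ob) (psi : ty_hom R (ty_tens T M) (ty_tens M T))
    (z : A) : (forall i : ty_idx T, ty_lab i = m) ->
  diag_slice (assoc_step (assoc_step psi)) (inl z) =
    \sum_a tau%:C * chi a z * (chi a a)^-1 * diag_slice psi (inl a).
Proof.
move=> Tm.
have labA (r : ty_idx (ty_tens M T)) : ty_lab r <> m.
  by move=> rm; have := fuse_lab r; rewrite rm Tm.
rewrite /diag_slice (partition_big
  (fun r : ty_idx (ty_tens M (ty_tens M (ty_tens M T))) => tsnd (tsnd r))
  xpredT) //.
rewrite (partition_big (fun r : ty_idx (ty_tens M T) => ty_lab r) xpredT) //.
rewrite sum_simple [X in _ + X](_ : _ = 0) ?addr0; last first.
  by rewrite big1 // => r /andP[_ /eqP/labA].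
apply: eq_bigr => a _; rewrite mulr_sumr; apply: eq_bigr => r /eqP ra.
(* r2 is the only summand with label z in m ⊗ (m ⊗ r) *)
have h1 : fuse m (ty_lab r) m by rewrite ra.
have [r1 [_ r12 r13]] := @tens_idx_mk A M (ty_tens M T) tt r m h1.
have h2 : fuse m (ty_lab r1) (inl z) by rewrite r13.
have [r2 [_ r22 r23]] := @tens_idx_mk A M (ty_tens M (ty_tens M T)) tt r1 _ h2.
rewrite (big_only1 r2) ?r22 ?r12 ?r23 ?eqxx //; last first.
  move=> r' ne /andP[/eqP r'3 /eqP r'r]; case/eqP: ne; apply: tens_idx_inj.
  - exact: unit_irr.
  - rewrite r22; apply: tens_idx_inj; rewrite ?r12 ?r13 //.
      exact: unit_irr.
    have := fuse_lab (tsnd r'); rewrite r'r ra.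
    by case: (ty_lab (tsnd r')) => [//|[]].
  - by rewrite r23.
rewrite slice_step ?r22 ?r23 // r12 slice_step ?ra ?r13 // r12 ?r23 ra ?r13 Tm /=.
by rewrite !mulrA; congr (_ * _); rewrite [LHS]mulrAC mulrC mulrA mulrAC.
Qed.

(** The recursion of [diag_slice_step] is convolution with [rho], after division
    by [rho]. *)
Lemma diag_slice_iter (rho : A -> C) : symmetric_bichar chi -> in_C chi rho ->
  forall (T : ty_ob) (psi : ty_hom R (ty_tens T M) (ty_tens M T)) (k : nat),
  (forall i : ty_idx T, ty_lab i = m) ->
  (forall z, diag_slice psi (inl z)
     = tau%:C ^+ k * conv_pow rho k.+1 z * (rho z)^-1) ->
  forall z, diag_slice (assoc_step (assoc_step psi)) (inl z)
     = tau%:C ^+ k.+1 * conv_pow rho k.+2 z * (rho z)^-1.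
Proof.
move=> chiC rhoC T psi k Tm IH z; rewrite diag_slice_step // conv_powS /conv.
rewrite mulrAC mulr_sumr.
(* the summation variable x of the convolution is z a^-1 *)
rewrite [in RHS](reindex_inj invg_inj) [in RHS](reindex_inj (mulIg z^-1%g)).
apply: eq_bigr => a _; rewrite IH invgK mulgVK invMg invgK.
rewrite (in_C_div chiM) // exprS.
have [r0 _] := rhoC; have [chi0 _ _] := chiM; field.
by rewrite !r0 chi0.
Qed.

(** * The matrix of the rotation *)

(** The component of [f : 1 -> m ⊗ T] along the summand [q] of T: at most one
    summand of m ⊗ q has label 1. *)
Definition strip (T : ty_ob) (f : ty_hom R (ty_unit A) (ty_tens M T))
    (q : ty_idx T) : C :=
  \sum_(r : ty_idx (ty_tens M T) | tsnd r == q) entry f tt r.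

(** The evaluation of m; the dual of m is m itself. *)
Definition evM : ty_hom R (ty_tens M M) (ty_unit A) := ty_ev tau M.

Lemma entry_evM c u : ty_lab c = e -> entry evM c u = tau%:C^-1.
Proof.
move=> ce; rewrite /evM /ty_ev entry_mkhom_lab //.
have -> : tfst c == tsnd c by apply/eqP/unit_irr.
by rewrite mul1r.
Qed.

(** The image in Hom(m ⊗ 1, T) of a morphism 1 -> m ⊗ T under the duality
    isomorphism A. *)
Definition bendA (T : ty_ob) (f : ty_hom R (ty_unit A) (ty_tens M T)) :
    ty_hom R (ty_tens M (ty_unit A)) T :=
  ty_comp (ty_lunit R T) (ty_comp (ty_tensm evM (ty_id R T))
    (ty_comp (ty_assoc_inv chi tau M M T) (ty_tensm (ty_id R M) f))).

(** The scalar tau of the inverse constraint for (m, m, m) cancels the scalar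
    tau^-1 of the evaluation. *)
Lemma entry_bendA (T : ty_ob) (f : ty_hom R (ty_unit A) (ty_tens M T)) p q :
  entry (bendA f) p q = strip f q.
Proof.
have pm : ty_lab p = m.
  by have := fuse_lab p; case: (ty_lab p) => // -[].
have [qm|qm] := eqVneq (ty_lab q) m; last first.
  rewrite /strip big1 => [|r /eqP rq].
    by apply: contraNeq qm => /entry_neq0_lab <-; rewrite pm.
  apply: contraNeq qm => /entry_neq0_lab re; have := fuse_lab r.
  by rewrite rq -re; case: (ty_lab q) => // -[].
have hr : fuse m (ty_lab q) e by rewrite qm.
have [r [r1 r2 r3]] := @tens_idx_mk A M T tt q e hr.
have -> : strip f q = entry f tt r.
  rewrite /strip (big_only1 r) ?r2 // => r' ne /eqP r'q.
  apply: contraNeq ne => /entry_neq0_lab r'e; apply/eqP/tens_idx_inj.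
  - exact: unit_irr.
  - by rewrite r'q.
  - by rewrite -r'e r3.
(* the only path from p to q goes through w1, w2 and w3, in this order *)
have hw1 : fuse m (ty_lab r) m by rewrite r3.
have [w1 [w11 w12 w13]] := @tens_idx_mk A M (ty_tens M T) tt r m hw1.
have [c [c1 c2 c3]] := @tens_idx_mk A M M tt tt e isT.
have hw2 : fuse (ty_lab c) (ty_lab q) m by rewrite c3 qm.
have [w2 [w21 w22 w23]] := @tens_idx_mk A (ty_tens M M) T c q m hw2.
have hw3 : fuse e (ty_lab q) m by rewrite qm.
have [w3 [w31 w32 w33]] := @tens_idx_mk A (ty_unit A) T tt q m hw3.
rewrite /bendA.
rewrite [LHS](@entry_comp_only _ _ _ _ _ _ _ _ w3) => [|w _ wq]; last first.
  apply: tens_idx_inj; first exact: unit_irr.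
    by rewrite w32; apply/eqP/natb_neq0/(entry_mkhom_neq0 wq).
  by rewrite (entry_neq0_lab wq) qm w33.
rewrite (@entry_comp_only _ _ _ _ _ _ _ _ w2) => [|w _ ww3]; last first.
  have [/entry_neq0_lab w31' /entry_id_neq0 w32'] := entry_tensm_neq0 ww3.
  apply: tens_idx_inj.
  - rewrite w21; apply: tens_idx_inj; try exact: unit_irr.
    by rewrite w31' c3.
  - by rewrite w32' w22.
  - by rewrite (entry_neq0_lab ww3) w23.
rewrite (@entry_comp_only _ _ _ _ _ _ _ _ w1) => [|w pw ww2]; last first.
  have [_ /entry_neq0_lab w2'] := entry_tensm_neq0 pw.
  have [_ _ w2''] := assoc_entry_neq0 (entry_mkhom_neq0 ww2).
  apply: tens_idx_inj; first exact: unit_irr.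
  - rewrite w12; apply: tens_idx_inj; first exact: unit_irr.
      by rewrite w2'' r2.
    by rewrite -w2' r3.
  - by rewrite -(entry_neq0_lab pw) w13.
rewrite [X in X * _ * _ * _]entry_tensm_lab ?w13 // entry_id w12.
have -> : tfst p == tfst w1 by apply/eqP/unit_irr.
rewrite [X in _ * X * _ * _]entry_mkhom_lab ?w13 //.
rewrite assoc_entry_eq ?w21 ?w22 ?w12 ?r2 //; try exact: unit_irr.
rewrite entry_tensm_lab ?w23 // w22 w32 w21 entry_id eqxx.
rewrite entry_evM // entry_mkhom_lab ?w33 // w32 eqxx c3 r3.
have tauC : tau%:C != 0 by rewrite fmorph_eq0.
rewrite mul1r !mulr1 /= (bichar1l chiM) mulr1 qm mulfK //.
by rewrite (unit_irr (tsnd p) tt).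
Qed.

(** The coevaluation of m. *)
Definition coevM : ty_hom R (ty_unit A) (ty_tens M M) := ty_coev R M.

(** The image in Hom(1, T ⊗ m) of a morphism 1 ⊗ m -> T under the duality
    isomorphism B. *)
Definition bendB (T : ty_ob) (g : ty_hom R (ty_tens (ty_unit A) M) T) :
    ty_hom R (ty_unit A) (ty_tens T M) :=
  ty_comp (ty_tensm g (ty_id R M))
    (ty_comp (ty_assoc_inv chi tau (ty_unit A) M M)
      (ty_comp (ty_tensm (ty_id R (ty_unit A)) coevM)
        (ty_runit_inv R (ty_unit A)))).

Lemma entry_bendB (T : ty_ob) (g : ty_hom R (ty_tens (ty_unit A) M) T) i s :
  ty_lab s = e -> entry (bendB g) i s =
    \sum_(p : ty_idx (ty_tens (ty_unit A) M)) entry g p (tfst s).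
Proof.
move=> se; have sm : ty_lab (tfst s) = m.
  have := fuse_lab s; rewrite se; case: (ty_lab (tfst s)) => [//|[]] //.
(* the only path from i to s goes through u, v and w, in this order *)
have hu : fuse e e e by rewrite /fuse mulg1.
have [u [u1 u2 u3]] := @tens_idx_mk A (ty_unit A) (ty_unit A) tt tt e hu.
have [c [c1 c2 c3]] := @tens_idx_mk A M M tt tt e isT.
have hv : fuse e (ty_lab c) e by rewrite c3.
have [v [v1 v2 v3]] := @tens_idx_mk A (ty_unit A) (ty_tens M M) tt c e hv.
have [p [p1 p2 p3]] := @tens_idx_mk A (ty_unit A) M tt tt m isT.
have hw : fuse (ty_lab p) m e by rewrite p3.
have [w [w1 w2 w3]] := @tens_idx_mk A (ty_tens (ty_unit A) M) M p tt e hw.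
have p_only p' : ty_lab p' = m -> p' = p.
  by move=> p'm; apply: tens_idx_inj; rewrite ?p3 //; exact: unit_irr.
rewrite [RHS](big_only1 p) //; last first.
  move=> p' ne _; apply: contraNeq ne => /entry_neq0_lab p's.
  by apply/eqP/p_only; rewrite p's.
rewrite /bendB (@entry_comp_only _ _ _ _ _ _ _ _ w) => [|w' _ w's]; last first.
  have [/entry_neq0_lab w'1 _] := entry_tensm_neq0 w's.
  apply: tens_idx_inj; last by rewrite (entry_neq0_lab w's) w3.
    by rewrite w1; apply: p_only; rewrite w'1.
  exact: unit_irr.
rewrite (@entry_comp_only _ _ _ _ _ _ _ _ v) => [|v' iv v'w]; last first.
  have v'e : ty_lab v' = e by rewrite (entry_neq0_lab v'w) w3.
  apply: tens_idx_inj; rewrite ?v3 //; first exact: unit_irr.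
  rewrite v2; apply: tens_idx_inj; try exact: unit_irr.
  have := fuse_lab v'; rewrite v'e c3; case: (ty_lab (tsnd v')) => [a|[]] //=.
  by rewrite mul1g => /eqP <-.
rewrite (@entry_comp_only _ _ _ _ _ _ _ _ u) => [|u' _ u'v]; last first.
  apply: tens_idx_inj; try exact: unit_irr.
  by rewrite u3 (entry_neq0_lab u'v) v3.
rewrite [X in X * _ * _ * _]entry_mkhom_lab; last by rewrite u3 (unit_irr i tt).
rewrite [X in _ * X * _ * _]entry_tensm_lab ?u3 ?v3 // entry_id v2.
rewrite (unit_irr (tfst u) i) (unit_irr (tfst v) i).
rewrite [X in _ * X * _]entry_mkhom_lab ?v3 ?w3 //.
rewrite assoc_entry_eq ?w1 ?v2 //; try exact: unit_irr.
rewrite entry_tensm_lab ?w3 // w1 entry_id (unit_irr (tsnd w) (tsnd s)).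
rewrite !eqxx /coevM /ty_coev entry_mkhom_lab //.
by rewrite c1 c2 eqxx /= !mul1r mulr1.
Qed.

(** The inverse of the pivotal structure at m, the scalar sgn(tau)^-1. *)
Definition pivM : ty_hom R M M := ty_piv_inv tau M.

(** The rotation of Hom(1, m ⊗ T) determined by a rebracketing morphism
    [psi : T ⊗ m -> m ⊗ T]; for T = m^(n-1) it is E^(n). *)
Definition rotate (T : ty_ob) (psi : ty_hom R (ty_tens T M) (ty_tens M T))
    (f : ty_hom R (ty_unit A) (ty_tens M T)) :
    ty_hom R (ty_unit A) (ty_tens M T) :=
  ty_comp psi (ty_comp (ty_tensm (ty_id R T) pivM)
    (bendB (ty_comp (bendA f) (ty_comp (ty_runit_inv R M) (ty_lunit R M))))).

(** Precomposition with the isomorphism 1 ⊗ m = m ⊗ 1 does not change the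
    scalars of a morphism: both objects have a single summand. *)
Lemma entry_unit_swap (T : ty_ob) (g : ty_hom R (ty_tens M (ty_unit A)) T)
    (c : ty_idx T -> C) : (forall p q, entry g p q = c q) ->
  forall q,
    \sum_p entry (ty_comp g (ty_comp (ty_runit_inv R M) (ty_lunit R M))) p q
      = c q.
Proof.
move=> gc q.
have [p [_ _ p3]] := @tens_idx_mk A (ty_unit A) M tt tt m isT.
have [p' [_ _ p'3]] := @tens_idx_mk A M (ty_unit A) tt tt m isT.
have p_lab (p0 : ty_idx (ty_tens (ty_unit A) M)) : ty_lab p0 = m.
  by have := fuse_lab p0; case: (ty_lab p0) => // -[].
have p'_lab (p0 : ty_idx (ty_tens M (ty_unit A))) : ty_lab p0 = m.
  by have := fuse_lab p0; case: (ty_lab p0) => // -[].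
rewrite (big_only1 p) // => [|p1 /eqP ne _]; last first.
  by case: ne; apply: tens_idx_inj; rewrite ?p_lab //; exact: unit_irr.
rewrite (@entry_comp_only _ _ _ _ _ _ _ _ p') => [|p1 _ _]; last first.
  by apply: tens_idx_inj; rewrite ?p'_lab //; exact: unit_irr.
rewrite gc (@entry_comp_only _ _ _ M _ _ _ _ tt) => [|x _ _]; last first.
  exact: unit_irr.
rewrite !entry_mkhom_lab ?p3 ?p'3 //.
by rewrite (unit_irr (tsnd p) tt) (unit_irr (tfst p') tt) !eqxx !mul1r.
Qed.

Lemma entry_rotate (T : ty_ob) (psi : ty_hom R (ty_tens T M) (ty_tens M T)) f
    i r : ty_lab r = e ->
  entry (rotate psi f) i r
    = \sum_r' entry f tt r' * ((Num.sg tau)%:C^-1 * slice psi (tsnd r') r).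
Proof.
move=> re; rewrite /rotate entry_comp.
(* the sum over the summands s of T ⊗ m, the source of psi *)
transitivity (\sum_(s : ty_idx (ty_tens T M))
    strip f (tfst s) * ((Num.sg tau)%:C^-1 * entry psi s r)).
  apply: eq_bigr => s _.
  have [->|/entry_neq0_lab sr] := eqVneq (entry psi s r) 0.
    by rewrite !mulr0.
  rewrite mulrA; congr (_ * _).
  rewrite (@entry_comp_only _ _ _ _ _ _ _ _ s) => [|s' _ s's]; last first.
    have [/entry_id_neq0 s1 _] := entry_tensm_neq0 s's.
    by apply: tens_idx_inj (entry_neq0_lab s's) => //; exact: unit_irr.
  rewrite entry_bendB ?sr ?re // entry_tensm_lab // entry_id eqxx mul1r.
  rewrite (entry_unit_swap (entry_bendA f)); congr (_ * _).
  by rewrite /pivM /ty_piv_inv entry_mkhom_lab // eqxx mul1r.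
under eq_bigr => s _ do rewrite /strip mulr_suml.
rewrite (exchange_big_dep xpredT) //=; apply: eq_bigr => r' _.
rewrite -mulr_sumr; congr (_ * _); rewrite -mulr_sumr; congr (_ * _).
by rewrite /slice; apply: eq_bigl => s; rewrite eq_sym.
Qed.

(** The coordinates of Hom(1, X) are the summands of X with label 1. *)
Lemma sum_hom_unit (X : ty_ob) (F : ty_idx X -> C) :
  \sum_(r | ty_lab r == e) F r = \sum_(p : ty_homidx (ty_unit A) X) F (val p).2.
Proof.
rewrite (reindex_omap (fun p : ty_homidx (ty_unit A) X => (val p).2)
  (fun r => insub (tt, r))).
  by apply: eq_bigl => -[[[] r] /= h]; rewrite eq_sym insubT h eqxx.
by move=> r re; rewrite insubT //= eq_sym.
Qed.

Lemma trace_rotate (T : ty_ob) (psi : ty_hom R (ty_tens T M) (ty_tens M T)) :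
  lin_trace (rotate psi) = (Num.sg tau)%:C^-1 * diag_slice psi e.
Proof.
rewrite (@lin_trace_ffun _ _ _ (fun p q : ty_homidx (ty_unit A) (ty_tens M T) =>
  (Num.sg tau)%:C^-1 * slice psi (tsnd (val p).2) (val q).2)) => [|f q].
  by rewrite /diag_slice mulr_sumr sum_hom_unit.
rewrite -entry_val entry_rotate; last by rewrite -(eqP (valP q)).
rewrite -(big_rmcond (fun r => ty_lab r == e)) => [|r re].
  rewrite sum_hom_unit; apply: eq_bigr => p _; rewrite -entry_val.
  by rewrite (unit_irr (val p).1 tt).
rewrite [entry f tt r](_ : _ = 0) ?mul0r //.
by apply: contraNeq re => /entry_neq0_lab <-.
Qed.

(** * The indicators *)

Local Notation V := (TYm chi tau).

(** The tensor power m^(n+1), and the rebracketing m^(n+1) ⊗ m -> m^(n+2); the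
    shift by one keeps the power in the form m ⊗ T at each step. *)
Definition mpow (n : nat) : ty_ob := tpow V n.+1.

Definition mpow_assoc (n : nat) :
    ty_hom R (ty_tens (mpow n) M) (ty_tens M (mpow n)) :=
  tpow_assoc V n.+1.

Lemma mpow_assocS n : mpow_assoc n.+1 = assoc_step (mpow_assoc n).
Proof. by []. Qed.

(** The splitting of m^(n+2) as m ⊗ m^(n+1) is an identity, so that E^(n+2) is
    a rotation. *)
Lemma FS_map_rotate n (f : ty_hom R (ty_unit A) (ty_tens M (mpow n))) :
  @FS_map C (TY chi tau) V n.+1 f = rotate (mpow_assoc n) f.
Proof. by rewrite -[in RHS](ty_comp1f f). Qed.

Lemma lab_tensM (U : ty_ob) (r : ty_idx (ty_tens M U)) :
  (ty_lab r == m) = (ty_lab (tsnd r) != m).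
Proof.
have := fuse_lab r.
by case: (ty_lab r) => [?|[]]; case: (ty_lab (tsnd r)) => [?|[]].
Qed.

Lemma mpow_lab n (i : ty_idx (mpow n)) : (ty_lab i == m) = ~~ odd n.
Proof.
elim: n i => [//|n IH] i.
by rewrite [LHS](@lab_tensM (mpow n) i) IH.
Qed.

Lemma diag_slice_tpow (rho : A -> C) (k : nat) (z : A) :
  symmetric_bichar chi -> in_C chi rho ->
  diag_slice (mpow_assoc k.*2) (inl z)
    = tau%:C ^+ k * conv_pow rho k.+1 z * (rho z)^-1.
Proof.
move=> chiC rhoC; have [r0 _] := rhoC.
elim: k z => [|k IH] z.
  by rewrite [LHS]diag_slice_id expr0 mul1r mulfV.
rewrite doubleS !mpow_assocS.
apply: (diag_slice_iter chiC rhoC _ IH) => i.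
by apply/eqP; rewrite mpow_lab odd_double.
Qed.

Lemma FS_indicator_odd n : odd n -> FS_indicator V n = 0.
Proof.
case: n => [//|n] on; apply: lin_trace_trivial => v.
apply/ffunP => p; have /eqP := valP p.
have := @mpow_lab n (val p).2; rewrite (negbTE on : odd n = false).
by move=> /eqP ->.
Qed.

Lemma FS_indicator_even n :
  FS_indicator V n.+2 = (Num.sg tau)%:C^-1 * diag_slice (mpow_assoc n) e.
Proof.
apply: etrans (trace_rotate (mpow_assoc n)).
exact: (@eq_lin_trace _ (ty_hom R (ty_unit A) (ty_tens M (mpow n))) _ _
  (@FS_map_rotate n)).
Qed.

End CyclicRotation.

Theorem theorem3p3 (R : realType) (A : finGroupType)
    (chi : A -> A -> R[i]) (tau : R) (n : nat) :
  abelian [set: A] ->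
  bicharacter chi -> symmetric_bichar chi -> nondegenerate_bichar chi ->
  tau ^+ 2 = #|A|%:R^-1 ->
  (1 <= n)%N ->
  (odd n -> FS_indicator (TYm chi tau) n = 0) /\
  (forall rho : A -> R[i], in_C chi rho ->
   forall k : nat, n = (2 * k)%N ->
     FS_indicator (TYm chi tau) n =
       (Num.sg tau)%:C ^+ k / sqrtC #|A|%:R * \sum_(a : A) fourier chi rho a ^+ k
     /\
     (Num.sg tau)%:C ^+ k / sqrtC #|A|%:R * \sum_(a : A) fourier chi rho a ^+ k =
       (Num.sg tau)%:C ^+ k / sqrtC #|A|%:R ^+ (k - 1) * conv_pow rho k 1%g).
Proof.
move=> _ chiM chiC chi_nd tau2 n0; split; first exact: FS_indicator_odd.
move=> rho rhoC [|k] nk; first by rewrite nk in n0.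
have N0 : #|A|%:R != 0 :> R.
  by rewrite pnatr_eq0 -lt0n; apply/card_gt0P; exists 1%g.
have tau0 : tau != 0 by rewrite -sqrf_eq0 tau2 invr_eq0.
have sN : sqrtC #|A|%:R = (`|tau|^-1)%:C :> R[i].
  rewrite -[RHS]sqrCK; last by rewrite lecR invr_ge0.
  by rewrite -rmorphXn /= exprVn real_normK ?num_real // tau2 invrK rmorph_nat.
(* s is the square root of |A|, and tau = sgn(tau) / s *)
set s := sqrtC _ in sN *.
have s0 : s != 0 by rewrite sN fmorph_eq0 invr_eq0 normr_eq0.
have sg2 : (Num.sg tau)%:C * (Num.sg tau)%:C = 1 :> R[i].
  by rewrite -rmorphM /= -expr2 sqr_sg tau0.
have sg0 : (Num.sg tau)%:C != 0 :> R[i] by rewrite fmorph_eq0 sgr_eq0.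
have sgV : (Num.sg tau)%:C^-1 = (Num.sg tau)%:C :> R[i].
  by apply: (mulfI sg0); rewrite mulfV ?sg2.
have tauE : tau%:C = (Num.sg tau)%:C / s.
  by rewrite sN [in LHS](numEsg tau) rmorphM fmorphV invrK.
rewrite subn1 [k.+1.-1]/=.
have E : (Num.sg tau)%:C ^+ k.+1 / s * \sum_a fourier chi rho a ^+ k.+1 =
       (Num.sg tau)%:C ^+ k.+1 / s ^+ k * conv_pow rho k.+1 1%g.
  rewrite (sum_fourier chiM chiC chi_nd) -/s -(sqrtCK #|A|%:R) -/s !exprS expr0.
  by field; rewrite s0 expf_neq0.
split; last exact: E.
rewrite E nk mul2n doubleS (FS_indicator_even chiM tau0).
rewrite (diag_slice_tpow _ chiM _ _ chiC rhoC).
rewrite (in_C1 chiM rhoC) invr1 mulr1 tauE expr_div_n exprS.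
by rewrite sgV !mulrA.
Qed.
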